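(* Let $K$ be a compactum such that the core decomposition $\mathcal{D}_K^{PC}$ of $K$ with Peano quotient exists. If $h:K\to L$ is a homeomorphism of $K$ onto $L$, then the core decomposition $\mathcal{D}_L^{PC}$ of $L$ with Peano quotient exists and equals $\{h(d): d\in\mathcal{D}_K^{PC}\}$.
   Context: A compactum is a compact metric space (not assumed to be planar); a continuum is a connected compactum; a Peano continuum is a locally connected continuum. A Peano compactum is a compact metric space all of whose components are Peano continua and such that for every $C>0$ all but finitely many of its components have diameter less than $C$. An upper semi-continuous decomposition $\mathcal{D}$ of a compactum $K$ is a partition of $K$ such that for every open set $B\subset K$ the union of all $d\in\mathcal{D}$ with $d\subset B$ is open in $K$; it carries the quotient topology from the natural projection $\pi:K\to\mathcal{D}$. It is a monotone decomposition if each of its elements is a subcontinuum of $K$; then the quotient is a compact metrizable space, regarded as a compactum with a compatible metric. If $\mathcal{D},\mathcal{D}'$ are monotone decompositions of $K$ with projections $\pi,\pi'$, then $\mathcal{D}$ is finer than $\mathcal{D}'$ if there is a map $g:\mathcal{D}\to\mathcal{D}'$ with $\pi'=g\circ\pi$. The core decomposition $\mathcal{D}_K^{PC}$ of $K$ with Peano quotient is, if it exists, the (unique) monotone decomposition of $K$ whose quotient space is a Peano compactum and which is finer than every other monotone decomposition of $K$ whose quotient space is a Peano compactum. *)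

(* Defs.v *)
From HB Require Import structures.
From mathcomp Require Import all_boot all_order all_algebra generic_quotient.
From mathcomp Require Import all_classical all_reals ereal topology.

Set Implicit Arguments.
Unset Strict Implicit.
Unset Printing Implicit Defensive.

Import Order.TTheory GRing.Theory Num.Theory.
Local Open Scope classical_set_scope.
Local Open Scope quotient_scope.
Local Open Scope ring_scope.

Definition homeomorphism (T U : topologicalType) (f : T -> U) : Prop :=
  continuous f /\ exists g : U -> T, [/\ continuous g, cancel f g & cancel g f].

Section Continua.
Context {T : topologicalType}.
Implicit Types (A C : set T).

Definition continuum A : Prop := compact A /\ connected A.

(* Local connectedness of A in the subspace topology: the relatively open
   neighbourhoods of x in A are the sets A `&` V with V open and V x. *)
Definition locally_connected A : Prop :=
  forall x (U : set T), A x -> open U -> U x ->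
  exists V : set T, [/\ open V, V x, A `&` V `<=` U & connected (A `&` V)].

Definition Peano_continuum A : Prop := continuum A /\ locally_connected A.

Definition is_component C : Prop :=
  exists x : T, C = connected_component [set: T] x.

End Continua.

Section PeanoCompactum.
Context {R : realType} (X : metricType R).

Definition compactum : Prop := compact [set: X].

Definition diam (A : set X) : \bar R :=
  ereal_sup [set (mdist x y)%:E | x in A & y in A].

Definition Peano_compactum : Prop :=
  [/\ compactum,
      forall C : set X, is_component C -> Peano_continuum C &
      forall c : R, 0 < c ->
        finite_set [set C : set X | is_component C /\ ~ (diam C < c%:E)%E]].

End PeanoCompactum.

Record usc_decomposition (K : topologicalType) := UscDecomposition {
  elements : set (set K) ;
  elements_partition : partition elements id [set: K] ;
  elements_usc : forall B : set K, open B ->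
    open (\bigcup_(d in [set d | elements d /\ d `<=` B]) d) }.

(* The points of the quotient space are the elements of the decomposition. *)
Definition element_type (K : topologicalType) (D : usc_decomposition K) : Type :=
  set_type (elements D).

Section Quotient.
Context (K : topologicalType) (D : usc_decomposition K).

Lemma element_exists (x : K) : exists d : element_type D, val d x.
Proof.
have [cD _ _] := elements_partition D.
have : cover (elements D) id x by rewrite cD.
by move=> [d Dd dx]; exists (SigSub (mem_set Dd)).
Qed.

Lemma element_nonempty (d : element_type D) : exists x : K, val d x.
Proof.
by have [_ _] := elements_partition D; apply; exact: set_mem (valP d).
Qed.

Definition element_of (x : K) : element_type D := sval (cid (element_exists x)).

Definition element_repr (d : element_type D) : K :=
  sval (cid (element_nonempty d)).

Lemma element_unique (d d' : element_type D) (x : K) :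
  val d x -> val d' x -> d = d'.
Proof.
move=> dx d'x; apply: val_inj.
have [_ tD _] := elements_partition D.
by apply: tD; [exact: set_mem (valP d)|exact: set_mem (valP d')|exists x].
Qed.

Lemma element_reprK : cancel element_repr element_of.
Proof.
move=> d; apply: (@element_unique _ _ (element_repr d)).
  exact: svalP (cid (element_exists _)).
exact: svalP (cid (element_nonempty d)).
Qed.

HB.instance Definition _ :=
  isQuotient.Build K (element_type D) element_reprK.

Definition quotient_space : topologicalType :=
  quotient_topology (element_type D).

Definition proj : K -> quotient_space :=
  \pi_(quotient_topology (element_type D)).

Lemma proj_mem (x : K) : sval (proj x : element_type D) x.
Proof.
by rewrite /proj unlock; exact: svalP (cid (element_exists x)).
Qed.

Definition monotone_decomposition : Prop :=
  forall d : set K, elements D d -> continuum d.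

(* The quotient space with some compatible metric is a Peano compactum. *)
Definition Peano_quotient (R : realType) : Prop :=
  exists (P : metricType R) (f : quotient_space -> P),
    homeomorphism f /\ Peano_compactum P.

End Quotient.

(* Continuity of g is automatic for the quotient topology. *)
Definition finer (K : topologicalType) (D D' : usc_decomposition K) : Prop :=
  exists g : quotient_space D -> quotient_space D',
    proj D' = g \o proj D.

Definition is_core_decomposition (R : realType) (K : metricType R)
    (D : usc_decomposition K) : Prop :=
  [/\ monotone_decomposition D,
      Peano_quotient D R &
      forall D' : usc_decomposition K,
        monotone_decomposition D' -> Peano_quotient D' R -> finer D D'].

(* Main.v *)
Require Import Defs.
From mathcomp Require Import all_boot all_order all_algebra.
From mathcomp Require Import all_classical all_reals topology.

Local Open Scope classical_set_scope.

Set Implicit Arguments.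
Unset Strict Implicit.
Unset Printing Implicit Defensive.

(* The projection onto the quotient, not the evaluation map of product types. *)
Local Notation proj := Defs.proj.

(** A homeomorphism transports every ingredient of the definition of a core
    decomposition.  If h : K -> L is a homeomorphism, the images under h of the
    elements of a decomposition D of K form a decomposition of L
    ([image_decomposition]).  It is monotone when D is, since continuous images
    of continua are continua, and its quotient space is homeomorphic to that of
    D ([homeomorphism_quotient]), so one is a Peano compactum exactly when the
    other is.

    Everything about refinement is expressed through the equivalence relation
    [proj D x = proj D y] of lying in a common element: [finer] is inclusion of
    these relations ([finerP]), and a decomposition is determined by its relation
    ([elements_fibers]).  The relation of the image decomposition is the one of D
    carried by h ([proj_image]).  To see that the image of the core
    decomposition of K refines a competitor E on L, pull E back to K along h,
    which gives a competitor there, and use that the core of K refines it.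

    That the core decomposition of L is nothing but this image is then the
    antisymmetry of refinement ([core_decomposition_unique]). *)

Section Fibers.
Context {K : topologicalType}.
Implicit Types D : usc_decomposition K.

Lemma proj_surj D (q : quotient_space D) : exists x, proj D x = q.
Proof. by exists (repr q); rewrite /proj reprK. Qed.

Lemma element_fiber D (d : set K) (x : K) :
  elements D d -> d x -> d = [set y | proj D y = proj D x].
Proof.
move=> Dd dx.
have projE z : d z -> sval (proj D z : element_type D) = d.
  move=> dz; have dz' : val (SigSub (mem_set Dd) : element_type D) z by [].
  by rewrite (element_unique (proj_mem D z) dz').
apply/seteqP; split=> y /=.
  by move=> dy; apply: val_inj; rewrite /= (projE _ dx) (projE _ dy).
by move=> yx; rewrite -(projE _ dx) -yx; exact: proj_mem.
Qed.

Lemma fiber_element D (x : K) : elements D [set y | proj D y = proj D x].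
Proof.
have Dd := set_mem (valP (proj D x : element_type D)).
by rewrite -(element_fiber Dd (proj_mem D x)).
Qed.

Lemma elements_fibers D :
  elements D = range (fun x => [set y | proj D y = proj D x]).
Proof.
apply/seteqP; split=> [d Dd|_ [x _ <-]]; last exact: fiber_element.
have [_ _ D0] := elements_partition D.
by have [x dx] := D0 _ Dd; exists x => //; rewrite -(element_fiber Dd dx).
Qed.

(** Since [proj D] is surjective, a map of quotients under [proj D'] can be built
    by choosing a preimage of each point. *)
Lemma finerP D D' :
  finer D D' <-> forall x y, proj D x = proj D y -> proj D' x = proj D' y.
Proof.
split=> [[g ->] x y /= -> //|DD'].
exists (fun q => proj D' (sval (cid (proj_surj q)))).
by apply/funext => x /=; apply: DD'; rewrite (svalP (cid (proj_surj _))).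
Qed.

Lemma finer_anti D D' : finer D D' -> finer D' D -> elements D = elements D'.
Proof.
move=> /finerP DD' /finerP D'D; rewrite !elements_fibers.
suff -> : (fun x => [set y | proj D y = proj D x]) =
          (fun x => [set y | proj D' y = proj D' x]) by [].
by apply/funext => x; apply/seteqP; split=> y; [apply: DD'|apply: D'D].
Qed.

End Fibers.

Lemma core_decomposition_unique {R : realType} {K : metricType R}
    (D D' : usc_decomposition K) :
  is_core_decomposition D -> is_core_decomposition D' ->
  elements D = elements D'.
Proof.
move=> [mD pD fD] [mD' pD' fD'].
by apply: finer_anti; [exact: fD|exact: fD'].
Qed.

Lemma homeomorphism_comp {T U V : topologicalType} (f : T -> U) (g : U -> V) :
  homeomorphism f -> homeomorphism g -> homeomorphism (g \o f).
Proof.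
move=> [cf [f' [cf' fK f'K]]] [cg [g' [cg' gK g'K]]].
split; first by move=> x; apply: continuous_comp; [exact: cf|exact: cg].
exists (f' \o g'); split; [|exact: can_comp|exact: can_comp].
by move=> x; apply: continuous_comp; [exact: cg'|exact: cf'].
Qed.

Lemma continuum_image {T U : topologicalType} (f : T -> U) (A : set T) :
  continuous f -> continuum A -> continuum (f @` A).
Proof.
move=> cf [kA cA]; have cfA := continuous_subspaceT cf.
by split; [exact: continuous_compact|exact: connected_continuous_connected].
Qed.

Section InducedMap.
Context {K L : topologicalType}.
Context (D : usc_decomposition K) (E : usc_decomposition L) (f : K -> L).

(** Under [fDE] below the value does not depend on the representative, and
    [induced] is the unique map with [induced \o proj D = proj E \o f]. *)
Definition induced (q : quotient_space D) : quotient_space E :=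
  proj E (f (repr q)).

Hypothesis fDE : forall x y,
  proj D x = proj D y -> proj E (f x) = proj E (f y).

Lemma induced_proj x : induced (proj D x) = proj E (f x).
Proof. by apply: fDE; rewrite /proj reprK. Qed.

Lemma induced_continuous : continuous f -> continuous induced.
Proof.
move=> cf; apply/continuousP => U oU.
have -> : open (induced @^-1` U) = open (f @^-1` (proj E @^-1` U)).
  (* Openness in the quotient is openness of the preimage under [proj D]. *)
  rewrite /open/= /quotient_open; congr (open _).
  apply/seteqP; split=> x /=; rewrite -/(proj D x) induced_proj //.
by move: cf => /continuousP; apply.
Qed.

End InducedMap.

Arguments induced {K L} D E f q.

(** The two-sided compatibility makes the maps induced by [h] and by its inverse
    mutually inverse bijections of the quotient spaces. *)
Lemma homeomorphism_quotient {K L : topologicalType}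
    (D : usc_decomposition K) (E : usc_decomposition L) (h : K -> L) :
  homeomorphism h ->
  (forall x y, proj E (h x) = proj E (h y) <-> proj D x = proj D y) ->
  homeomorphism (induced D E h).
Proof.
move=> [ch [g [cg hK gK]]] hDE.
have hP x y : proj D x = proj D y -> proj E (h x) = proj E (h y).
  by move/hDE.
have gP u v : proj E u = proj E v -> proj D (g u) = proj D (g v).
  by move=> uv; apply/hDE; rewrite !gK.
split; first exact: induced_continuous.
exists (induced E D g); split; first exact: induced_continuous.
- by move=> q; have [x <-] := proj_surj q; rewrite !induced_proj ?hK.
- by move=> q; have [u <-] := proj_surj q; rewrite !induced_proj ?gK.
Qed.

Section ImageDecomposition.
Context {K L : topologicalType} (h : K -> L) (g : L -> K).
Hypotheses (ch : continuous h) (cg : continuous g).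
Hypotheses (hK : cancel h g) (gK : cancel g h).
Variable D : usc_decomposition K.

Lemma image_partition : partition [set h @` d | d in elements D] id [set: L].
Proof.
have [cD tD D0] := elements_partition D; split.
- apply/seteqP; split=> // u _.
  have [d Dd dgu] : cover (elements D) id (g u) by rewrite cD.
  by exists (h @` d); [exists d|exists (g u)].
- move=> _ _ [d Dd <-] [e De <-] [_ [[x dx <-] [y ey hyx]]].
  congr (_ @` _); apply: tD => //; exists x; split=> //.
  by rewrite -(can_inj hK hyx).
- by move=> _ [d Dd <-]; have [x dx] := D0 _ Dd; exists (h x), x.
Qed.

Lemma image_usc (B : set L) : open B ->
  open (\bigcup_(e in
    [set e | [set h @` d | d in elements D] e /\ e `<=` B]) e).
Proof.
move=> oB; set S := \bigcup_(_ in _) _.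
(* An element [h @` d] lies in [B] exactly when [d] lies in [h @^-1` B]. *)
have -> : S = g @^-1`
    (\bigcup_(d in [set d | elements D d /\ d `<=` h @^-1` B]) d).
  apply/seteqP; split=> u.
    move=> [_ [[d Dd <-] dB] [x dx <-]] /=; rewrite hK.
    by exists d => //; split=> // y dy; apply: dB; exists y.
  move=> [d [Dd dB] dgu]; exists (h @` d); last by exists (g u).
  by split; [exists d|move=> _ [y dy <-]; exact: dB].
move: cg => /continuousP; apply; apply: elements_usc.
by move: ch => /continuousP; apply.
Qed.

Definition image_decomposition : usc_decomposition L :=
  UscDecomposition image_partition image_usc.

Lemma proj_image x y :
  proj image_decomposition (h x) = proj image_decomposition (h y) <->
  proj D x = proj D y.
Proof.
have Ey : elements image_decomposition (h @` [set z | proj D z = proj D y]).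
  by exists [set z | proj D z = proj D y] => //; exact: fiber_element.
have /(element_fiber Ey)/seteqP[sub sup] :
  (h @` [set z | proj D z = proj D y]) (h y) by exists y.
split=> [/sup[z zy /(can_inj hK) <-]//|xy].
by apply: sub; exists x.
Qed.

Lemma monotone_image :
  monotone_decomposition D -> monotone_decomposition image_decomposition.
Proof. by move=> mD _ [d Dd <-]; apply: continuum_image => //; exact: mD. Qed.

Lemma Peano_quotient_image (R : realType) :
  Peano_quotient D R -> Peano_quotient image_decomposition R.
Proof.
move=> [P [f [hf PP]]].
(* The quotient of the image maps to that of [D] through the inverse of [h]. *)
exists P, (f \o induced image_decomposition D g); split=> //.
apply: homeomorphism_comp hf; apply: homeomorphism_quotient.
  by split=> //; exists h.
by move=> u v; rewrite -{2}(gK u) -{2}(gK v); split=> /proj_image.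
Qed.

End ImageDecomposition.

(** A competitor [E] on [L] becomes a competitor on [K] by taking its image under
    the inverse [g]; it is there that the minimality of [D] applies. *)
Lemma core_decomposition_image {R : realType} {K L : metricType R}
    (h : K -> L) (g : L -> K) (ch : continuous h) (cg : continuous g)
    (hK : cancel h g) (gK : cancel g h) (D : usc_decomposition K) :
  is_core_decomposition D ->
  is_core_decomposition (image_decomposition ch cg hK gK D).
Proof.
move=> [mD pD finest]; split.
- exact: monotone_image.
- exact: Peano_quotient_image.
move=> E mE pE; apply/finerP => u v.
rewrite -{1}(gK u) -{1}(gK v) => /proj_image uv.
have /finerP DE : finer D (image_decomposition cg ch gK hK E).
  by apply: finest; [exact: monotone_image|exact: Peano_quotient_image].
by move: (DE _ _ uv) => /proj_image.
Qed.

Unset Implicit Arguments.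

Theorem theorem7p2 (R : realType) (K L : metricType R)
  (compactK : compactum K)
  (DK : usc_decomposition K) (coreDK : is_core_decomposition DK)
  (h : K -> L) (homeoh : homeomorphism h) :
  (exists DL : usc_decomposition L, is_core_decomposition DL) /\
  (forall DL : usc_decomposition L, is_core_decomposition DL ->
     elements DL = [set h @` d | d in elements DK]).
Proof.
have [ch [g [cg hK gK]]] := homeoh.
have coreDL := core_decomposition_image ch cg hK gK coreDK.
split; first by exists (image_decomposition ch cg hK gK DK).
by move=> DL coreDL'; rewrite (core_decomposition_unique coreDL' coreDL).
Qed.
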